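(* The linear ordering $$(0)<(1)<\cdots<(n)<\cdots<(x-n)<\cdots<(x-2)<(x-1)$$ on the polynomial alphabet extends to a linear ordering on the positive polynomials of $\mathbb{Z}[x]$, and to one on $\mathbb{Z}[x]$ by symmetry: we have $$\begin{aligned}[][(0)]_x&<[(1)]_x<\cdots<[(x-1)]_x<[(1)(0)]_x\\&<[(1)(1)]_x<\cdots<[(1)(x-1)]_x<[(2)(0)]_x\\&\ \ \vdots\\&<[(x-2)(1)]_x<\cdots<[(x-2)(x-1)]_x<[(x-1)(0)]_x\\&<[(x-1)(1)]_x<\cdots<[(x-1)(x-1)]_x<[(1)(0)(0)]_x\\&<[(1)(0)(1)]_x<\cdots,\end{aligned}$$ i.e. positive polynomials are compared first by their number of base-$x$ digits (more digits is larger) and, when these numbers are equal, lexicographically by digits starting from the leading digit. Every polynomial in $\mathbb{Z}[x]$ has an immediate successor and an immediate predecessor in this ordering, obtained by adding, respectively subtracting, $[(1)]_x=1$.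
   Context: A polynomial $f\in\mathbb{Z}[x]$ is called positive if its leading coefficient is positive. The polynomial alphabet is the set of digits $\{0,1,2,\dots\}\cup\{x-1,x-2,\dots\}$. Every positive $f\in\mathbb{Z}[x]$ has a unique base-$x$ representation $f(x)=\sum_{i=0}^m b_i(x)x^i$ with digits $b_i(x)$ in the polynomial alphabet and $b_m(x)\ne 0$; it is written $f=[(b_m(x))\cdots(b_1(x))(b_0(x))]_x$ and has $m+1$ digits. The zero polynomial is $[(0)]_x$. Extension ''by symmetry'' means: $0$ is smaller than every positive polynomial, every $f$ with $-f$ positive is smaller than $0$ and than every positive polynomial, and for $-f,-g$ positive, $f<g$ if and only if $-g<-f$. *)

(* Defs.v *)
From HB Require Import structures.
From mathcomp Require Import all_boot all_order all_algebra.

Set Implicit Arguments.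
Unset Strict Implicit.
Unset Printing Implicit Defensive.

Import Order.TTheory GRing.Theory Num.Theory.
Local Open Scope ring_scope.

Definition positive (f : {poly int}) : bool := 0 < lead_coef f.

(* [Below k] stands for the digit x - (k + 1), so that the polynomial alphabet
   {0, 1, 2, ...} U {x - 1, x - 2, ...} is in bijection with [digit]. *)
Inductive digit := Const of nat | Below of nat.

Definition digit_poly (d : digit) : {poly int} :=
  match d with
  | Const n => n%:R
  | Below k => 'X - k.+1%:R
  end.

Definition digit_sum (d : digit) : nat + nat :=
  match d with Const n => inl n | Below k => inr k end.
Definition sum_digit (u : nat + nat) : digit :=
  match u with inl n => Const n | inr k => Below k end.
Lemma digit_sumK : cancel digit_sum sum_digit. Proof. by case. Qed.

HB.instance Definition _ := Countable.copy digit (can_type digit_sumK).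

(* (0) < (1) < ... < (n) < ... < (x - n) < ... < (x - 2) < (x - 1) *)
Definition digit_le (a b : digit) : bool :=
  match a, b with
  | Const m, Const n => (m <= n)%N
  | Const _, Below _ => true
  | Below _, Const _ => false
  | Below j, Below k => (k <= j)%N
  end.
Definition digit_lt (a b : digit) : bool := (b != a) && digit_le a b.

Fact digit_le_anti : antisymmetric digit_le.
Proof.
by move=> [m|j] [n|k] //= /anti_leq => [-> | <-].
Qed.

Fact digit_le_trans : transitive digit_le.
Proof.
move=> [n|k] [m|j] [p|l] //=; first exact: leq_trans.
by move=> kj lk; apply: leq_trans lk kj.
Qed.

Fact digit_le_total : total digit_le.
Proof. by move=> [m|j] [n|k] //=; exact: leq_total. Qed.

Fact digit_display : Order.disp_t. Proof. exact: Order.Disp tt tt. Qed.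

HB.instance Definition _ := Order.isOrder.Build digit_display digit
  (fun _ _ => erefl) (fun _ _ => erefl) (fun _ _ => erefl)
  digit_le_anti digit_le_trans digit_le_total.

(* Digit strings are written as on paper, the leading digit b_m first:
   [base_x [:: b_m; ...; b_1; b_0]] is the sum of the b_i(x) x^i. *)
Definition base_x (s : seq digit) : {poly int} :=
  \sum_(i < size s) digit_poly (nth (Const 0) (rev s) i) * 'X^i.

(* [s] is nonempty: the default of [head] is the digit 0. *)
Definition base_x_repr (f : {poly int}) (s : seq digit) : Prop :=
  f = base_x s /\ (s = [:: Const 0] \/ head (Const 0) s != Const 0).

Definition digits_lt (s t : seq digit) : Prop :=
  (size s < size t)%N \/
  size s = size t /\ (s < t :> seqlexi digit)%O.

Inductive poly_lt (f g : {poly int}) : Prop :=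
| LtPosPos s t of positive f & positive g
    & base_x_repr f s & base_x_repr g t & digits_lt s t
| LtZeroPos of f = 0 & positive g
| LtNegZero of positive (- f) & g = 0
| LtNegPos of positive (- f) & positive g
| LtNegNeg s t of positive (- f) & positive (- g)
    & base_x_repr (- g) s & base_x_repr (- f) t & digits_lt s t.

Definition strict_linear_order_on (T : Type) (P : pred T)
    (R : T -> T -> Prop) : Prop :=
  [/\ forall f, P f -> ~ R f f,
      forall f g h, P f -> P g -> P h -> R f g -> R g h -> R f h
    & forall f g, P f -> P g -> [\/ R f g, f = g | R g f]].

Definition immediate_succ (T : Type) (R : T -> T -> Prop) (f g : T) : Prop :=
  R f g /\ ~ (exists h, R f h /\ R h g).

Definition immediate_pred (T : Type) (R : T -> T -> Prop) (f g : T) : Prop :=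
  R g f /\ ~ (exists h, R g h /\ R h f).

(* Main.v *)
(* The order is that of Z[x] as an ordered ring: f < g iff g - f has a positive
   leading coefficient.  In it 1 is the least positive element, so distinct
   digits differ by at least 1 and every digit is at most x - 1; hence n-digit
   strings have values in [0, x^n[, and in [x^(n-1), x^n[ when the leading digit
   is nonzero.  This gives the comparison by length and then lexicographically,
   and f + 1 is the successor of f because nothing lies strictly between
   0 and 1. *)
Require Import Defs.
From HB Require Import structures.
From mathcomp Require Import all_boot all_order all_algebra.
From mathcomp Require Import ring.

Set Implicit Arguments.
Unset Strict Implicit.
Unset Printing Implicit Defensive.

Import Order.TTheory GRing.Theory Num.Theory.
Local Open Scope ring_scope.

(** * Positive and nonnegative elements of Z[x] *)

Lemma lead_coef_polyC_nat (n : nat) : lead_coef (n%:R : {poly int}) = n%:R.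
Proof. by rewrite -polyC_natr lead_coefC. Qed.

Lemma positiveW (f : {poly int}) : positive f -> 0 <= lead_coef f.
Proof. exact: ltW. Qed.

Lemma positiveXn (n : nat) : positive 'X^n.
Proof. by rewrite /positive lead_coefXn. Qed.

Lemma positive_trichotomy (f : {poly int}) :
  [\/ positive f, f = 0 | positive (- f)].
Proof.
rewrite /positive lead_coefN oppr_gt0.
case: (ltrgt0P (lead_coef f)) => [f_gt0 | f_lt0 | f0].
- by constructor 1.
- by constructor 3.
- by constructor 2; apply/eqP; rewrite -lead_coef_eq0 f0.
Qed.

(* Since [lead_coef f = 0] only for [f = 0], the condition [0 <= lead_coef f]
   expresses that f is zero or positive. *)
Lemma nonneg_eqVpositive (f : {poly int}) :
  0 <= lead_coef f -> f = 0 \/ positive f.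
Proof.
move=> f_ge0; case: (positive_trichotomy f); [by right | by left |].
by rewrite /positive lead_coefN oppr_gt0 ltNge f_ge0.
Qed.

Lemma not_positive0 : ~~ positive 0.
Proof. by rewrite /positive lead_coef0. Qed.

(** For equal sizes the leading coefficients are added and, both being positive, cannot cancel. *)
Lemma positiveD (f g : {poly int}) : positive f -> positive g -> positive (f + g).
Proof.
rewrite /positive => f_gt0 g_gt0; case: (ltngtP (size f) (size g)) => fg.
- by rewrite addrC lead_coefDl.
- by rewrite lead_coefDl.
suff sfg : size (f + g) = size f.
  rewrite lead_coefE sfg coefD {2}fg -!lead_coefE; exact: addr_gt0.
apply/eqP; rewrite eqn_leq (leq_trans (size_polyD _ _)) ?fg ?maxnn //=.
rewrite -fg leqNgt; apply/negP => lt_fg.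
have: (f + g)`_(size f).-1 = 0.
  apply: nth_default; rewrite -ltnS (ltn_predK (m := 0)) //.
  by rewrite size_poly_gt0 -lead_coef_eq0 gt_eqF.
rewrite coefD {2}fg -!lead_coefE => fg0.
by have := addr_gt0 f_gt0 g_gt0; rewrite fg0.
Qed.

Lemma nonnegD_positive (f g : {poly int}) :
  0 <= lead_coef f -> positive g -> positive (f + g).
Proof.
by case/nonneg_eqVpositive => [-> | f_gt0] g_gt0; rewrite ?add0r //; apply: positiveD.
Qed.

Lemma nonnegD (f g : {poly int}) :
  0 <= lead_coef f -> 0 <= lead_coef g -> 0 <= lead_coef (f + g).
Proof.
move=> f_ge0 /nonneg_eqVpositive[-> | g_gt0]; first by rewrite addr0.
exact/positiveW/nonnegD_positive.
Qed.

Lemma nonnegM (f g : {poly int}) :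
  0 <= lead_coef f -> 0 <= lead_coef g -> 0 <= lead_coef (f * g).
Proof. by rewrite lead_coefM; exact: mulr_ge0. Qed.

Lemma positiveN (f : {poly int}) : positive f -> ~~ positive (- f).
Proof. by rewrite /positive lead_coefN oppr_gt0 -leNgt => /ltW. Qed.

(** Discreteness of the order: subtracting 1 alters the leading coefficient only of a constant, and
    a positive integer is at least 1. *)
Lemma positive_subr1 (f : {poly int}) : positive f -> 0 <= lead_coef (f - 1).
Proof.
rewrite /positive => f_gt0.
have f_neq0 : f != 0 by rewrite -lead_coef_eq0 gt_eqF.
case: (ltnP 1 (size f)) => [f_big | f_small].
  by rewrite lead_coefDl ?ltW // size_polyN size_poly1.
move: f_gt0; rewrite (size1_polyC f_small) -polyC1 -polyCB !lead_coefC => c_gt0.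
by rewrite subr_ge0 -gtz0_ge1.
Qed.

(** * Bounds on digits *)

Lemma positiveX_sub_nat (n : nat) : positive ('X - n%:R).
Proof. by rewrite -polyC_natr /positive lead_coefXsubC. Qed.

Lemma digit_poly_ge0 (a : digit) : 0 <= lead_coef (digit_poly a).
Proof.
case: a => [n | k] /=; first by rewrite lead_coef_polyC_nat ler0n.
exact/positiveW/positiveX_sub_nat.
Qed.

Lemma digit_poly_ltX (a : digit) : positive ('X - digit_poly a).
Proof.
case: a => [n | k] /=; first exact: positiveX_sub_nat.
by rewrite subKr /positive lead_coef_polyC_nat ltr0n.
Qed.

Lemma positive_natB (m n : nat) : (m < n)%N -> positive (n%:R - m%:R).
Proof.
by move=> mn; rewrite -natrB 1?ltnW // /positive lead_coef_polyC_nat ltr0n subn_gt0.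
Qed.

Lemma digit_poly_lt (a b : digit) :
  (a < b)%O -> positive (digit_poly b - digit_poly a).
Proof.
rewrite lt_neqAle; case: a b => [m | j] [n | k] /andP[ab] le_ab //=.
- apply: positive_natB; rewrite ltn_neqAle; exact/andP.
- have -> : 'X - k.+1%:R - m%:R = 'X - (k.+1 + m)%:R :> {poly int} by ring.
  exact: positiveX_sub_nat.
have -> : 'X - k.+1%:R - ('X - j.+1%:R) = j.+1%:R - k.+1%:R :> {poly int} by ring.
apply: positive_natB; rewrite ltnS ltn_neqAle eq_sym; exact/andP.
Qed.

(** * Values of digit strings *)

Lemma base_x_cons (a : digit) (s : seq digit) :
  base_x (a :: s) = digit_poly a * 'X^(size s) + base_x s.
Proof.
rewrite /base_x /= big_ord_recr /= rev_cons nth_rcons size_rev ltnn eqxx addrC.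
by congr (_ + _); apply: eq_bigr => i _; rewrite nth_rcons size_rev ltn_ord.
Qed.

Lemma base_x_rcons (s : seq digit) (a : digit) :
  base_x (rcons s a) = base_x s * 'X + digit_poly a.
Proof.
rewrite /base_x size_rcons rev_rcons big_ord_recl /= expr0 mulr1 addrC mulr_suml.
by congr (_ + _); apply: eq_bigr => i _; rewrite /= exprSr mulrA.
Qed.

Lemma base_x_nil : base_x [::] = 0.
Proof. by rewrite /base_x big_ord0. Qed.

Lemma base_x_digit (a : digit) : base_x [:: a] = digit_poly a.
Proof. by rewrite base_x_cons base_x_nil expr0 mulr1 addr0. Qed.

Lemma base_x_ge0 (s : seq digit) : 0 <= lead_coef (base_x s).
Proof.
elim: s => [|a s IHs]; first by rewrite base_x_nil lead_coef0.
rewrite base_x_cons; apply: nonnegD => //.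
apply: nonnegM; [exact: digit_poly_ge0 | exact/positiveW/positiveXn].
Qed.

(** The leading digit is at most ['X - 1], which leaves at least one ['X^(size s)]; by induction
    this exceeds the value of the remaining digits. *)
Lemma base_x_ltXn (s : seq digit) : positive ('X^(size s) - base_x s).
Proof.
elim: s => [|a s IHs]; first by rewrite base_x_nil subr0 positiveXn.
have -> : 'X^(size (a :: s)) - base_x (a :: s) =
    ('X - digit_poly a - 1) * 'X^(size s) + ('X^(size s) - base_x s).
  by rewrite base_x_cons /= exprS; ring.
apply: nonnegD_positive => //; apply: nonnegM; last exact/positiveW/positiveXn.
exact/positive_subr1/digit_poly_ltX.
Qed.

(* A larger leading digit wins because it is larger by at least 1, whereas
   the remaining digits contribute less than x ^ size s. *)
Lemma base_x_lexi (s t : seq digit) : size s = size t ->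
  (s < t :> seqlexi digit)%O -> positive (base_x t - base_x s).
Proof.
elim: s t => [|a s IHs] [|b t] //= [st].
rewrite Order.SeqLexiOrder.Exports.ltxi_cons => /andP[le_ab /implyP lt_st].
case: (boolP (b <= a)%O) => [le_ba | ].
  have -> : a = b by apply/le_anti; rewrite le_ab.
  have -> : base_x (b :: t) - base_x (b :: s) = base_x t - base_x s.
    by rewrite !base_x_cons st; ring.
  exact: IHs st (lt_st le_ba).
rewrite -ltNge => /digit_poly_lt/positive_subr1 ba1.
have -> : base_x (b :: t) - base_x (a :: s) =
    (digit_poly b - digit_poly a - 1) * 'X^(size s) + base_x t
      + ('X^(size s) - base_x s).
  by rewrite !base_x_cons st; ring.
apply: nonnegD_positive (base_x_ltXn s).
by apply: nonnegD (base_x_ge0 t); apply: nonnegM ba1 (positiveW (positiveXn _)).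
Qed.

Lemma base_x_geXn (a : digit) (s : seq digit) :
  a != Const 0 -> 0 <= lead_coef (base_x (a :: s) - 'X^(size s)).
Proof.
move=> a_neq0; have /digit_poly_lt : (Const 0 < a)%O.
  by rewrite lt_neqAle eq_sym a_neq0; case: (a).
rewrite subr0 => /positive_subr1 a1.
have -> : base_x (a :: s) - 'X^(size s) =
  (digit_poly a - 1) * 'X^(size s) + base_x s by rewrite base_x_cons; ring.
by apply: nonnegD (base_x_ge0 s); apply: nonnegM a1 (positiveW (positiveXn _)).
Qed.

Lemma leXn (m n : nat) :
  (m <= n)%N -> 0 <= lead_coef ('X^n - 'X^m : {poly int}).
Proof.
move=> mn; have -> : 'X^n - 'X^m = ('X^(n - m) - 1) * 'X^m :> {poly int}.
  by rewrite mulrBl mul1r -exprD subnK.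
by apply: nonnegM (positive_subr1 (positiveXn _)) (positiveW (positiveXn _)).
Qed.

(** * Comparison of representations *)

Lemma base_x_repr_nonnil (f : {poly int}) : ~ base_x_repr f [::].
Proof. by case=> _ []. Qed.

(** If [s] is shorter, then [base_x s < x^(size s) <= x^(size t - 1) <= base_x t], the last step
    because [t] has a nonzero leading digit. *)
Lemma digits_lt_positive (f g : {poly int}) (s t : seq digit) :
  base_x_repr f s -> base_x_repr g t -> digits_lt s t -> positive (g - f).
Proof.
move=> fs gt [lt_st | [st lt_st]]; last first.
  by case: fs gt => -> _ [-> _]; exact: base_x_lexi.
have s_gt0 : (0 < size s)%N by case: s fs {lt_st} => // /base_x_repr_nonnil.
(* The string [[:: Const 0]] has length 1, so as [t] it would force [s] to be empty. *)
case: fs => -> _; case: gt => -> [t0 | ]; first by move: lt_st s_gt0; rewrite t0; case: size.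
case: t lt_st => [|b t] //= lt_st b_neq0.
have -> : base_x (b :: t) - base_x s = base_x (b :: t) - 'X^(size t)
    + ('X^(size t) - 'X^(size s)) + ('X^(size s) - base_x s) by ring.
apply: nonnegD_positive (base_x_ltXn s).
apply: nonnegD; [exact: base_x_geXn | exact: leXn].
Qed.

Lemma digits_lt_total (s t : seq digit) :
  [\/ digits_lt s t, s = t | digits_lt t s].
Proof.
case: (ltngtP (size s) (size t)) => st; [by constructor 1; left | by constructor 3; left |].
case: (ltgtP (s : seqlexi digit) t) => lt_st; last by constructor 2.
- by constructor 1; right.
- by constructor 3; right.
Qed.

(** The converse uses totality of [digits_lt]: equal strings would give [g - f = 0], and the
    opposite order would make [f - g] positive. *)
Lemma digits_ltE (f g : {poly int}) (s t : seq digit) :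
  base_x_repr f s -> base_x_repr g t -> digits_lt s t <-> positive (g - f).
Proof.
move=> fs gt; split; first exact: digits_lt_positive fs gt.
case: (digits_lt_total s t) => // [st | /(digits_lt_positive gt fs)].
  by case: fs gt => -> _ [-> _]; rewrite st subrr (negPf not_positive0).
by rewrite -opprB => /positiveN; rewrite opprK => /negPf ->.
Qed.

(** * Existence of representations *)

Lemma base_x_repr_rcons (f : {poly int}) (s : seq digit) (a : digit) :
  positive f -> base_x_repr f s -> base_x_repr (f * 'X + digit_poly a) (rcons s a).
Proof.
move=> f_gt0 [fs s_ok]; split; first by rewrite base_x_rcons fs.
right; case: s_ok fs => [-> | ] fs.
  by move: f_gt0; rewrite fs base_x_digit (negPf not_positive0).
by case: (s) fs.
Qed.

Lemma base_x_repr_digit (a : digit) : base_x_repr (digit_poly a) [:: a].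
Proof.
split; first by rewrite base_x_digit.
by case: (eqVneq a (Const 0)) => [-> | ]; [left | right].
Qed.

(* A negative constant coefficient [- k.+1] is written as the digit
   [x - k.+1], borrowing 1 from the coefficient of x. *)
Lemma base_x_repr_exists (f : {poly int}) :
  0 <= lead_coef f -> exists s, base_x_repr f s.
Proof.
have [n] := ubnP (size f); elim: n => // n IHn in f *; rewrite ltnS => sz_f f_ge0.
(* For [g = 0], appending [a] to [[:: Const 0]] would create a leading zero, so the one-digit string
   is taken instead. *)
have step (g : {poly int}) (a : digit) : (size g < n)%N -> 0 <= lead_coef g ->
    exists s, base_x_repr (g * 'X + digit_poly a) s.
  move=> sz_g /[dup] g_ge0 /nonneg_eqVpositive[-> | g_gt0].
    by exists [:: a]; rewrite mul0r add0r; exact: base_x_repr_digit.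
  by have [s gs] := IHn g sz_g g_ge0; exists (rcons s a); exact: base_x_repr_rcons.
case: (eqVneq f 0) => [-> | f_neq0].
  by exists [:: Const 0]; exact: (base_x_repr_digit (Const 0)).
have [q [c fE]] : exists (q : {poly int}) (c : int), f = q * 'X + c%:P.
  by elim/poly_ind: (f) => [|q c _]; [exists 0, 0; rewrite mul0r addr0 | exists q, c].
have sz_q : (size q < n)%N.
  apply: leq_trans sz_f; rewrite fE size_MXaddC; case: ifP => // /andP[/eqP q0 /eqP c0].
  by case/eqP: f_neq0; rewrite fE q0 c0 mul0r addr0.
have lead_f : q != 0 -> lead_coef f = lead_coef q.
  move=> q_neq0; rewrite fE lead_coefDl ?lead_coefMX // size_mulX //.
  by rewrite (leq_ltn_trans (size_polyC_leq1 _)) // ltnS size_poly_gt0.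
have q_ge0 : 0 <= lead_coef q.
  by case: (eqVneq q 0) => [-> | /lead_f <- //]; rewrite lead_coef0.
case: c fE => [c | c] fE.
  by rewrite fE -[c%:Z]natz polyC_natr; exact: (step q (Const c)).
have -> : f = (q - 1) * 'X + digit_poly (Below c).
  by rewrite fE NegzE -[c.+1%:Z]natz polyCN polyC_natr /=; ring.
(* If [q] were 0, [f] would be a negative constant. Hence [q - 1] is nonnegative, and its size is at
   most that of [q]. *)
have q_gt0 : positive q.
  case: (nonneg_eqVpositive q_ge0) => // q0.
  by move: f_ge0; rewrite fE q0 mul0r add0r lead_coefC.
apply: step (positive_subr1 q_gt0); apply: leq_ltn_trans sz_q.
rewrite (leq_trans (size_polyD _ _)) // size_polyN size_poly1 geq_max leqnn.
by rewrite size_poly_gt0 -lead_coef_eq0 gt_eqF.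
Qed.

(** * The order through the sign of differences *)

(** Existing representations supply the strings that the digit clauses ask for; for two negatives,
    [g - f] equals [- f - (- g)]. *)
Lemma poly_ltE (f g : {poly int}) : poly_lt f g <-> positive (g - f).
Proof.
split.
  case=> [s t _ _ fs gt | -> | f_lt0 -> | f_lt0 g_gt0 | s t _ _ gs ft].
  - exact: digits_lt_positive.
  - by rewrite subr0.
  - by rewrite sub0r.
  - exact: positiveD.
  - by move=> /(digits_lt_positive gs ft); rewrite opprK addrC.
case: (positive_trichotomy f) => [f_gt0 | -> | f_lt0].
- move=> gf_gt0; have g_gt0 : positive g by rewrite -(subrK f g); exact: positiveD.
  have [s fs] := base_x_repr_exists (positiveW f_gt0).
  have [t gt] := base_x_repr_exists (positiveW g_gt0).
  by apply: (LtPosPos f_gt0 g_gt0 fs gt); apply/(digits_ltE fs gt).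
- by rewrite subr0; exact: LtZeroPos.
case: (positive_trichotomy g) => [g_gt0 _ | -> _ | g_lt0 gf_gt0].
- exact: LtNegPos.
- exact: LtNegZero.
have [s gs] := base_x_repr_exists (positiveW g_lt0).
have [t ft] := base_x_repr_exists (positiveW f_lt0).
by apply: (LtNegNeg f_lt0 g_lt0 gs ft); apply/(digits_ltE gs ft); rewrite opprK addrC.
Qed.

Lemma poly_lt_strict_linear_order (P : pred {poly int}) :
  strict_linear_order_on P poly_lt.
Proof.
split=> [f _ | f g h _ _ _ | f g _ _].
- by move/poly_ltE; rewrite subrr (negPf not_positive0).
- by move=> /poly_ltE fg /poly_ltE gh; apply/poly_ltE; rewrite -(subrKA g); exact: positiveD.
case: (positive_trichotomy (g - f)) => [fg | /eqP | gf].
- by constructor 1; apply/poly_ltE.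
- by rewrite subr_eq0 => /eqP ->; constructor 2.
- by constructor 3; apply/poly_ltE; rewrite -opprB.
Qed.

Lemma digit_poly_ltE (a b : digit) :
  poly_lt (digit_poly a) (digit_poly b) <-> (a < b)%O.
Proof.
split=> [/poly_ltE | /digit_poly_lt]; last by move/poly_ltE.
case: (ltgtP a b) => // [/digit_poly_lt | ->]; last by rewrite subrr (negPf not_positive0).
by move/positiveN; rewrite opprB => /negPf ->.
Qed.

(** For [h] strictly between, [h - f - 1] is nonnegative and [f + 1 - h] is positive, yet their sum
    is 0. *)
Lemma poly_lt_addr1 (f : {poly int}) : immediate_succ poly_lt f (f + 1).
Proof.
have pos1 : positive 1 by rewrite /positive lead_coef1.
split; first by apply/poly_ltE; rewrite addrC addKr.
case=> h [/poly_ltE/positive_subr1 fh /poly_ltE hf].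
have := nonnegD_positive fh hf; have -> : h - f - 1 + (f + 1 - h) = 0 by ring.
by rewrite (negPf not_positive0).
Qed.

Theorem theorem4 :
  (* a linear order on the positive polynomials, and on all of Z[x] *)
  [/\ strict_linear_order_on positive poly_lt
    & strict_linear_order_on predT poly_lt] /\
  (* extending the order of the alphabet *)
  (forall a b : digit,
     poly_lt (digit_poly a) (digit_poly b) <-> (a < b)%O) /\
  (* number of digits first, then lexicographically from the leading digit *)
  (forall (f g : {poly int}) (s t : seq digit),
     base_x_repr f s -> base_x_repr g t ->
     (poly_lt f g <->
        (size s < size t)%N \/
        (size s = size t /\ (s < t :> seqlexi digit)%O))) /\
  (* symmetry *)
  [/\ forall g : {poly int}, positive g -> poly_lt 0 g,
      forall f : {poly int}, positive (- f) -> poly_lt f 0,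
      forall f g : {poly int}, positive (- f) -> positive g -> poly_lt f g
    & forall f g : {poly int}, positive (- f) -> positive (- g) ->
        (poly_lt f g <-> poly_lt (- g) (- f))] /\
  (* immediate successors and predecessors *)
  base_x [:: Const 1] = 1 /\
  (forall f : {poly int},
     immediate_succ poly_lt f (f + base_x [:: Const 1]) /\
     immediate_pred poly_lt f (f - base_x [:: Const 1])).
Proof.
have base1 : base_x [:: Const 1] = 1 by rewrite base_x_digit.
split; first by split; exact: poly_lt_strict_linear_order.
split; first exact: digit_poly_ltE.
split.
  move=> f g s t fs gt; apply: iff_trans (poly_ltE f g) _.
  exact: iff_sym (digits_ltE fs gt).
split; first split.
- by move=> g; exact: LtZeroPos.
- by move=> f f_lt0; exact: LtNegZero.
- by move=> f g; exact: LtNegPos.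
- move=> f g _ _; apply: iff_trans (poly_ltE f g) _.
  by apply: iff_sym; rewrite addrC -{2}[g]opprK; exact: poly_ltE.
split; rewrite // base1 => f; split; first exact: poly_lt_addr1.
(* That [f - 1] precedes [f] immediately unfolds to [f] being the immediate successor of [f - 1]. *)
by have := poly_lt_addr1 (f - 1); rewrite subrK.
Qed.
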